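(* Let $\mathbf{k}$ be an algebraically closed field of characteristic $p>0$, let $K=\mathbf{k}(u,v)$ be the rational function field in two variables $u,v$ over $\mathbf{k}$, and let $K_1=K(x)$, where $u=x^p/(1-x^{p-1})$. Let $\nu$ be the valuation on $K$ determined by the generating sequence $P_0=u$, $P_1=v$, $P_2=v^{p^2}-u$ and $P_{i+1}=P_i^{p^2}-u^{p^{2i-2}}P_{i-1}$ for $i\ge 2$ in $R=\mathbf{k}[u,v]_{(u,v)}$. Let $\nu_1$ be the unique extension of $\nu$ to $K_1$. Then $(K_1,\nu_1)$ is a dependent Artin-Schreier defect extension of $(K,\nu)$.
   Context: Valuations. For a valued field $(F,\nu)$, $\nu F$ denotes the value group and $F\nu$ the residue field. An extension of valued fields $(L|F,\nu)$ is immediate if $\nu L=\nu F$ and $L\nu=F\nu$. Defect. If $L|F$ is a finite extension and the extension of $\nu$ from $F$ to $L$ is unique, then $[L:F]=(\nu L:\nu F)\cdot[L\nu:F\nu]\cdot p^s$ with $s\ge 0$, where $p$ is the characteristic of $F\nu$ if it is positive (and $p=1$ otherwise); $p^s$ is the defect, and $(L|F,\nu)$ is a defect extension if $p^s>1$. Artin-Schreier extensions. In characteristic $p>0$, an Artin-Schreier extension of $F$ is an extension of degree $p$ generated over $F$ by a root $\theta$ of a polynomial $X^p-X-a$ with $a\in F$; such a $\theta$ is called an Artin-Schreier generator. An Artin-Schreier defect extension $(F(\theta)|F,\nu)$, with $\theta^p-\theta\in F$, is called dependent if there exists an immediate purely inseparable extension $(F(\eta)|F,\nu)$ of degree $p$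 such that $\nu(\theta-c)=\nu(\eta-c)$ for all $c\in F$ (this does not depend on the choice of the Artin-Schreier generator $\theta$). Otherwise it is called independent. In the claim, $1/x$ is an Artin-Schreier generator of $K_1$ over $K$, being a root of $X^p-X-\frac1u$. Generating sequences. Let $R$ be a two-dimensional regular local ring with quotient field $K$ and let $\nu$ be a valuation of $K$ centered in $R$. For $\gamma\in\nu(R\setminus\{0\})$ let $I_\gamma=\{f\in R\mid \nu(f)\ge\gamma\}$. A sequence $\{P_i\}$ of elements of $R$ is a generating sequence of $\nu$ if for every $\gamma\in\nu(R\setminus\{0\})$ the ideal $I_\gamma$ is generated by $\{\prod_i P_i^{a_i}\mid a_i\in\mathbb{N}_0,\ \sum_i a_i\nu(P_i)\ge\gamma\}$ (finite products). The valuation $\nu$. It is the valuation of $K$, trivial on $\mathbf{k}$ and centered in $R=\mathbf{k}[u,v]_{(u,v)}$, having the stated sequence $\{P_i\}_{i\ge0}$ as a generating sequence. Normalized by $\nu(u)=1$, it satisfies $\nu(P_0)=1$ and $\nu(P_i)=\sum_{j=0}^{i-1}p^{4j-2i}$ for $i\ge 1$; its value group is $\bigcup_{i\ge0}\frac{1}{p^i}\mathbb{Z}$. *)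

(* Defs.v *)
From HB Require Import structures.
From mathcomp Require Import all_boot all_order all_algebra all_field.
Set Implicit Arguments.
Unset Strict Implicit.
Unset Printing Implicit Defensive.
Import Order.TTheory GRing.Theory Num.Theory.
Local Open Scope ring_scope.
Local Open Scope quotient_scope.

(* The value of 0 is infinity; a valuation is represented by its restriction  *)
(* to the nonzero elements, and [nu 0 : rat] is an arbitrary number that no   *)
(* definition below looks at. Values lie in rat, the divisible hull of every  *)
(* value group contained in it, hence large enough to hold the values of all  *)
(* algebraic extensions.                                                      *)
Record valuation (F : fieldType) := Valuation {
  val_fun :> F -> rat;
  val_funM : forall x y : F, x != 0 -> y != 0 ->
    val_fun (x * y) = val_fun x + val_fun y;
  val_funD : forall x y : F, x != 0 -> y != 0 -> x + y != 0 ->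
    Num.min (val_fun x) (val_fun y) <= val_fun (x + y)
}.

Section ResidueField.
Context (F : fieldType) (nu : valuation F).

Definition val_ge (g : rat) (x : F) : bool := (x == 0) || (g <= nu x).
Definition val_gt (g : rat) (x : F) : bool := (x == 0) || (g < nu x).

Lemma val_fun1 : nu 1 = 0.
Proof.
have := val_funM nu (oner_neq0 F) (oner_neq0 F).
by rewrite mulr1 => /eqP; rewrite -subr_eq subrr => /eqP/esym.
Qed.

Lemma val_funV x : x != 0 -> nu x^-1 = - nu x.
Proof.
move=> x0; apply/eqP; rewrite -addr_eq0 -val_funM ?invr_eq0 //.
by rewrite mulVf // val_fun1.
Qed.

Lemma val_funN x : x != 0 -> nu (- x) = nu x.
Proof.
move=> x0; have n10 : (-1 : F) != 0 by rewrite oppr_eq0 oner_eq0.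
have h : nu (-1) + nu (-1) = 0 by rewrite -val_funM // mulrNN mulr1 val_fun1.
rewrite -mulN1r val_funM //; suff -> : nu (-1) = 0 by rewrite add0r.
by apply/eqP; move/eqP: h; rewrite -mulr2n mulrn_eq0.
Qed.

Lemma val_geD g x y : val_ge g x -> val_ge g y -> val_ge g (x + y).
Proof.
rewrite /val_ge; have [->|x0] := eqVneq x 0; first by rewrite add0r.
have [->|y0] := eqVneq y 0; first by rewrite addr0 (negPf x0).
have [//|xy0] := eqVneq (x + y) 0 => /= hx hy.
by apply: le_trans (val_funD nu x0 y0 xy0); rewrite le_min hx.
Qed.

Lemma val_gtD g x y : val_gt g x -> val_gt g y -> val_gt g (x + y).
Proof.
rewrite /val_gt; have [->|x0] := eqVneq x 0; first by rewrite add0r.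
have [->|y0] := eqVneq y 0; first by rewrite addr0 (negPf x0).
have [//|xy0] := eqVneq (x + y) 0 => /= hx hy.
by apply: lt_le_trans (val_funD nu x0 y0 xy0); rewrite lt_min hx.
Qed.

Lemma val_geN g x : val_ge g (- x) = val_ge g x.
Proof. by rewrite /val_ge oppr_eq0; case: eqVneq => //= ?; rewrite val_funN. Qed.

Lemma val_gtN g x : val_gt g (- x) = val_gt g x.
Proof. by rewrite /val_gt oppr_eq0; case: eqVneq => //= ?; rewrite val_funN. Qed.

Lemma val_geM g h x y : val_ge g x -> val_ge h y -> val_ge (g + h) (x * y).
Proof.
rewrite /val_ge mulf_eq0; case: (eqVneq x 0) => //= x0.
by case: (eqVneq y 0) => //= y0 hx hy; rewrite val_funM // lerD.
Qed.

Lemma val_ge_gtM g h x y : val_ge g x -> val_gt h y -> val_gt (g + h) (x * y).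
Proof.
rewrite /val_ge /val_gt mulf_eq0; case: (eqVneq x 0) => //= x0.
by case: (eqVneq y 0) => //= y0 hx hy; rewrite val_funM // ler_ltD.
Qed.

Definition in_val_ring : {pred F} := val_ge 0.

Lemma in_val_ring_subring : subring_closed in_val_ring.
Proof.
split=> [|x y hx hy|x y hx hy]; rewrite unfold_in.
- by rewrite /in_val_ring /val_ge val_fun1 lexx orbT.
- by apply: val_geD => //; rewrite val_geN.
- by have := val_geM hx hy; rewrite addr0.
Qed.

HB.instance Definition _ :=
  GRing.isSubringClosed.Build F in_val_ring in_val_ring_subring.

Record val_ring := ValRing { val_ring_val : F; _ : val_ring_val \in in_val_ring }.
HB.instance Definition _ := [isSub for val_ring_val].
HB.instance Definition _ := [Choice of val_ring by <:].
HB.instance Definition _ := [SubChoice_isSubComNzRing of val_ring by <:].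

Definition val_max_ideal : {pred val_ring} := fun x => val_gt 0 (val x).

Lemma val_max_ideal_closed : idealr_closed val_max_ideal.
Proof.
split=> [||a x y hx hy]; rewrite ?unfold_in /val_max_ideal ?raddf0.
- by rewrite /val_gt eqxx.
- by rewrite rmorph1 /val_gt val_fun1 ltxx orbF oner_neq0.
- rewrite rmorphD rmorphM; apply: val_gtD => //.
  by have := val_ge_gtM (valP a) hx; rewrite addr0.
Qed.

HB.instance Definition _ :=
  isIdealr.Build val_ring val_max_ideal val_max_ideal_closed.

Definition residue_field := {ideal_quot val_max_ideal}.

HB.instance Definition _ := GRing.ComNzRing.on residue_field.

Local Notation cls := (\pi_{ideal_quot val_max_ideal}).

(* Meaningful for x in the valuation ring; residue x = 0 otherwise.           *)
Definition residue (x : F) : residue_field := cls (insubd 0 x).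

Lemma residueE x y : val_ge 0 x -> val_ge 0 y ->
  (residue x == residue y) = val_gt 0 (x - y).
Proof.
move=> hx hy; rewrite /residue -Quotient.idealrBE unfold_in /val_max_ideal.
by rewrite rmorphB /= !insubdK.
Qed.

Lemma residue_val (a : val_ring) : residue (val a) = cls a.
Proof. by rewrite /residue valKd. Qed.

Lemma residue_repr (c : residue_field) :
  residue (val (repr c : val_ring)) = c.
Proof. by rewrite residue_val reprK. Qed.

Lemma residue0 : residue 0 = 0.
Proof. by rewrite -(rmorph0 (val : val_ring -> F)) residue_val rmorph0. Qed.

Lemma residue1 : residue 1 = 1.
Proof. by rewrite -(rmorph1 (val : val_ring -> F)) residue_val rmorph1. Qed.

Lemma residueD x y : val_ge 0 x -> val_ge 0 y ->
  residue (x + y) = residue x + residue y.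
Proof.
move=> hx hy; rewrite -(SubK val_ring hx) -(SubK val_ring hy).
by rewrite -rmorphD !residue_val rmorphD.
Qed.

Lemma residueM x y : val_ge 0 x -> val_ge 0 y ->
  residue (x * y) = residue x * residue y.
Proof.
move=> hx hy; rewrite -(SubK val_ring hx) -(SubK val_ring hy).
by rewrite -rmorphM !residue_val rmorphM.
Qed.

Lemma residue_eq0 x : val_ge 0 x -> (residue x == 0) = val_gt 0 x.
Proof. by move=> hx; rewrite -residue0 residueE ?subr0 // /val_ge eqxx. Qed.

Lemma residue_out x : ~~ val_ge 0 x -> residue x = 0.
Proof. by move=> hx; rewrite /residue /insubd insubN //= rmorph0. Qed.

Definition residue_inv (c : residue_field) : residue_field :=
  residue (val (repr c : val_ring))^-1.

Lemma residue_inv0 : residue_inv 0 = 0.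
Proof.
rewrite /residue_inv; set x := val _.
have hx : val_ge 0 x by apply: valP.
have : val_gt 0 x by rewrite -residue_eq0 // residue_repr.
rewrite /val_gt; have [->|x0] := eqVneq x 0; first by rewrite invr0 residue0.
move=> /= x_gt0; apply: residue_out.
by rewrite /val_ge invr_eq0 (negPf x0) val_funV // oppr_ge0 -ltNge.
Qed.

Lemma residue_mulVf (c : residue_field) : c != 0 -> residue_inv c * c = 1.
Proof.
rewrite /residue_inv -{1 3}[c]residue_repr; set x := val _.
have hx : val_ge 0 x by apply: valP.
rewrite residue_eq0 // negb_or => /andP[x0 nx0].
have hV : val_ge 0 x^-1 by rewrite /val_ge val_funV // oppr_ge0 leNgt nx0 orbT.
by rewrite -residueM // mulVf // residue1.
Qed.

HB.instance Definition _ :=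
  GRing.ComNzRing_isField.Build residue_field residue_mulVf residue_inv0.

End ResidueField.

(* The value group nu F, as a subset of rat.                                  *)
Definition value_group (F : fieldType) (nu : valuation F) (g : rat) : Prop :=
  exists2 x : F, x != 0 & nu x = g.

(* For subgroups H <= G of rat: (G : H) = n.                                  *)
Definition group_index (G H : rat -> Prop) (n : nat) : Prop :=
  exists2 r : 'I_n -> rat, forall i, G (r i) &
    forall g, G g -> exists! i, H (g - r i).

Section ValuedExtension.
Context (F : fieldType) (L : fieldExtType F).
Context (nuF : valuation F) (nuL : valuation L).

Definition extends : Prop := forall x : F, x != 0 -> nuL x%:A = nuF x.

(* The embedding of residue fields induced by F -> L when nuL extends nuF.    *)
Definition residue_emb (c : residue_field nuF) : residue_field nuL :=
  residue nuL (val (repr c : val_ring nuF))%:A.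

Lemma residue_embE x : extends -> val_ge nuF 0 x ->
  residue_emb (residue nuF x) = residue nuL x%:A.
Proof.
move=> ext hx; rewrite /residue_emb; set y := val _.
have hy : val_ge nuF 0 y by apply: valP.
have in0 z : (z%:A == 0 :> L) = (z == 0) by rewrite scaler_eq0 oner_eq0 orbF.
have geA z : val_ge nuF 0 z -> val_ge nuL 0 z%:A.
  by rewrite /val_ge in0; have [//|z0] := eqVneq z 0; rewrite ext.
apply/eqP; rewrite residueE ?geA // -scalerBl.
have : val_gt nuF 0 (y - x) by rewrite -residueE // residue_repr.
by rewrite /val_gt in0; have [//|z0] := eqVneq (y - x) 0; rewrite ext.
Qed.

Definition ramification_index (e : nat) : Prop :=
  group_index (value_group nuL) (value_group nuF) e.

(* [L nu : F nu] = f, that is, L nu has a basis of f elements over F nu.      *)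
Definition residue_degree (f : nat) : Prop :=
  exists b : 'I_f -> residue_field nuL, forall y : residue_field nuL,
    exists! c : {ffun 'I_f -> residue_field nuF},
      y = \sum_(i < f) residue_emb (c i) * b i.

Definition immediate : Prop :=
  [/\ extends,
      forall g, value_group nuL g <-> value_group nuF g &
      forall y : residue_field nuL, exists c, residue_emb c = y].

Definition unique_extension : Prop :=
  extends /\
  forall nuL' : valuation L, (forall x : F, x != 0 -> nuL' x%:A = nuF x) ->
    forall y : L, y != 0 -> nuL' y = nuL y.

(* [d] is a power of the residue characteristic, and is 1 when the latter     *)
(* is 0.                                                                      *)
Definition defect (d : nat) : Prop :=
  [/\ unique_extension, [pchar residue_field nuF].-nat d &
      exists e f : nat, [/\ ramification_index e, residue_degree f &
        \dim {:L} = (e * f * d)%N]].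

Definition defect_extension : Prop := exists2 d, defect d & (1 < d)%N.

End ValuedExtension.

Definition Artin_Schreier_generator (p : nat) (F : fieldType)
    (L : fieldExtType F) (theta : L) : Prop :=
  [/\ p \in [pchar F], \dim {:L} = p, <<1; theta>>%VS = {:L}%VS &
      exists a : F, theta ^+ p - theta = a%:A].

Definition Artin_Schreier_defect_extension (p : nat) (F : fieldType)
    (L : fieldExtType F) (nuF : valuation F) (nuL : valuation L) : Prop :=
  (exists theta : L, Artin_Schreier_generator p theta) /\
  defect_extension nuF nuL.

(* The condition does not depend on the Artin-Schreier generator theta.       *)
Definition dependent_Artin_Schreier_defect_extension (p : nat) (F : fieldType)
    (L : fieldExtType F) (nuF : valuation F) (nuL : valuation L) : Prop :=
  Artin_Schreier_defect_extension p nuF nuL /\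
  exists2 theta : L, Artin_Schreier_generator p theta &
    exists (E : fieldExtType F) (nuE : valuation E) (eta : E),
      [/\ immediate nuF nuE,
          purely_inseparable 1 {:E},
          \dim {:E} = p,
          <<1; eta>>%VS = {:E}%VS &
          forall c : F, nuL (theta - c%:A) = nuE (eta - c%:A)].

Section GeneratingSequence.
Context (F : fieldType) (R : F -> Prop) (nu : valuation F).

(* The exponents (a_i) of a monomial in the P_i form a finite sequence.       *)
Definition monomial (P : nat -> F) (a : seq nat) : F :=
  \prod_(i < size a) P i ^+ nth 0%N a i.

Definition monomial_value (P : nat -> F) (a : seq nat) : rat :=
  \sum_(i < size a) nu (P i) *+ nth 0%N a i.

(* Membership in the ideal of R generated by the elements satisfying S.       *)
Definition ideal_generated (S : F -> Prop) (f : F) : Prop :=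
  exists (n : nat) (c m : 'I_n -> F),
    [/\ forall j, R (c j), forall j, S (m j) & f = \sum_(j < n) c j * m j].

Definition valuation_ideal (g : rat) (f : F) : Prop := R f /\ val_ge nu g f.

Definition generating_sequence (P : nat -> F) : Prop :=
  (forall i, R (P i) /\ P i != 0) /\
  forall g : rat, (exists f, [/\ R f, f != 0 & nu f = g]) ->
    forall f, valuation_ideal g f <->
      ideal_generated
        (fun m => exists2 a, g <= monomial_value P a & m = monomial P a) f.

End GeneratingSequence.

Section RationalFunctions.
Context (k : fieldType).

(* k(u,v) is the fraction field of k[u][v].                                   *)
Definition ratfun2 : fieldType := {fraction {poly {poly k}}}.

Definition ratfun2_const (c : k) : ratfun2 := tofrac (c%:P)%:P.
Definition ratfun2_u : ratfun2 := tofrac ('X : {poly k})%:P.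
Definition ratfun2_v : ratfun2 := tofrac 'X.

(* The local ring k[u,v]_(u,v) and its maximal ideal; [b.[0].[0]] is b(0,0).  *)
Definition local_ring_uv (f : ratfun2) : Prop :=
  exists a b : {poly {poly k}}, b.[0].[0] != 0 /\ f = tofrac a / tofrac b.
Definition local_ring_uv_max (f : ratfun2) : Prop :=
  exists a b : {poly {poly k}},
    [/\ a.[0].[0] = 0, b.[0].[0] != 0 & f = tofrac a / tofrac b].

Definition centered_in_local_ring_uv (nu : valuation ratfun2) : Prop :=
  forall f, local_ring_uv f ->
    val_ge nu 0 f /\ (val_gt nu 0 f <-> local_ring_uv_max f).

End RationalFunctions.

(* Main.v *)
Require Import Defs.
From HB Require Import structures.
From mathcomp Require Import all_boot all_order all_algebra all_field.
From mathcomp Require Import zify ring lra.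
Import Order.TTheory GRing.Theory Num.Theory.
Local Open Scope ring_scope.

(* The Artin-Schreier generator theta = 1/x satisfies theta^p - theta = w with *)
(* w = 1/u; it is compared with eta, where eta^p = w. One has                  *)
(* (theta - c)^p = (w - c^p) + theta for c in K, so if nu(w - c^p) < -1/p for  *)
(* all c, then theta - c and eta - c both have value nu(w - c^p)/p. These      *)
(* values are bounded and their supremum is not attained, which by a Newton    *)
(* iteration forces every polynomial f of degree less than p to satisfy        *)
(* f(theta) ~ f(c) for c in K close to theta, and likewise for eta: hence both *)
(* extensions are immediate, of degree p, with a unique extension of nu.       *)
(*   The supremum of nu(u - c^p) is G = p^4/(p^4-1). The recursion for the P_i *)
(* yields approximations whose values tend to G. For the upper bound, let D be *)
(* the partial derivative in u: nu(D P_i) > nu(P_i) - G for all i, and as      *)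
(* {P_i} is a generating sequence, nu(D f) > nu(f) - G for all f in R. With    *)
(* f = u b^p - a^p one gets D f = b^p, so nu(u - (a/b)^p) < G.                 *)

(** * Valuations *)

(** The passage from u to w = 1/u shifts the supremum: u^-1 - c^p = (c^-p - u) c^p / u, and near the
    supremum nu(c^p) = -1, so the values nu(w - c^p) have the unattained supremum G - 2, which lies
    below -1/p ([inv_sub_pth_power_lt], [inv_sub_pth_power_sup], [u_dist_lt]). The supremum G for u
    comes from [sub_pth_power_lt] and [sub_pth_power_sup]. From there
    [dependent_Artin_Schreier_criterion] concludes; its engine is the Newton argument in
    [taylor_dominated_lt]. *)

Section ValuationTheory.
Context {F : fieldType} {nu : valuation F}.

Lemma val_ge_le {g h x} : h <= g -> val_ge nu g x -> val_ge nu h x.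
Proof. by rewrite /val_ge => hg /orP[->//|/(le_trans hg) ->]; rewrite orbT. Qed.

Lemma val_gt_le {g h x} : h <= g -> val_gt nu g x -> val_gt nu h x.
Proof. by rewrite /val_gt => hg /orP[->//|/(le_lt_trans hg) ->]; rewrite orbT. Qed.

Lemma val_ge_gt {g h x} : h < g -> val_ge nu g x -> val_gt nu h x.
Proof. by rewrite /val_gt => hg /orP[->//|/(lt_le_trans hg) ->]; rewrite orbT. Qed.

Lemma val_gtW {g x} : val_gt nu g x -> val_ge nu g x.
Proof. by rewrite /val_ge => /orP[->//|/ltW ->]; rewrite orbT. Qed.

Lemma val_ge0 g : val_ge nu g 0. Proof. by rewrite /val_ge eqxx. Qed.

Lemma val_gt0 g : val_gt nu g 0. Proof. by rewrite /val_gt eqxx. Qed.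

Lemma val_ge_val x : val_ge nu (nu x) x.
Proof. by rewrite /val_ge lexx orbT. Qed.

Lemma val_geB {g x y} : val_ge nu g x -> val_ge nu g y -> val_ge nu g (x - y).
Proof. by move=> hx hy; rewrite val_geD // val_geN. Qed.

Lemma val_gtB {g x y} : val_gt nu g x -> val_gt nu g y -> val_gt nu g (x - y).
Proof. by move=> hx hy; rewrite val_gtD // val_gtN. Qed.

Lemma val_ge_sum (I : Type) (r : seq I) (Q : pred I) (G : I -> F) g :
  (forall i, Q i -> val_ge nu g (G i)) -> val_ge nu g (\sum_(i <- r | Q i) G i).
Proof.
by move=> hG; elim/big_ind: _ => // [|x y]; [exact: val_ge0|exact: val_geD].
Qed.

Lemma val_funX x n : x != 0 -> nu (x ^+ n) = nu x *+ n.
Proof.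
move=> x0; elim: n => [|n IH]; first by rewrite expr0 mulr0n val_fun1.
by rewrite exprS val_funM ?expf_neq0 // IH mulrS.
Qed.

Lemma val_add_dominant {x y} : x != 0 -> val_gt nu (nu x) y ->
  x + y != 0 /\ nu (x + y) = nu x.
Proof.
move=> x0 hy; have xy0 : x + y != 0.
  apply/eqP => /eqP; rewrite addr_eq0 => /eqP hx; move: hy x0.
  by rewrite hx /val_gt oppr_eq0; case: eqVneq => //= y0; rewrite val_funN // ltxx.
split=> //; apply/eqP; rewrite eq_le; apply/andP; split; last first.
  by have /orP[/negPn|//] := val_geD (val_ge_val x) (val_gtW hy); rewrite xy0.
rewrite leNgt; apply/negP => lt.
have : val_gt nu (nu x) ((x + y) - y) by rewrite val_gtB // /val_gt lt orbT.
by rewrite addrK /val_gt (negPf x0) ltxx.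
Qed.

(** Frobenius fixes the prime field, so n^p = n and p nu(n) = nu(n). *)
Lemma val_nat_pchar {p n} : p \in [pchar F] -> n%:R != 0 :> F -> nu n%:R = 0.
Proof.
move=> pF n0; have p1 := prime_gt1 (pcharf_prime pF).
have := val_funX _ p n0; rewrite -(pFrobenius_autE pF) pFrobenius_aut_nat.
rewrite -[nu _ *+ p]mulr_natr => h.
have p1r : (1 : rat) < p%:R by rewrite ltr1n.
have /eqP : nu n%:R * (p%:R - 1) = 0 by rewrite mulrBr -h mulr1 subrr.
by rewrite mulf_eq0 subr_eq0 (gt_eqF p1r) orbF => /eqP.
Qed.

End ValuationTheory.

(** * Polynomials of degree less than p along approximations *)

Lemma deriv_nderivn (R : nzRingType) (f : {poly R}) i :
  f^`()^`N(i) = f^`N(i.+1) *+ i.+1.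
Proof.
apply/polyP=> j; rewrite coefMn !coef_nderivn coef_deriv -!mulrnA addSn.
congr (_ *+ _); rewrite [RHS]mulnC -mul_bin_diag.
by rewrite mulnC.
Qed.

Section NewtonApproximation.
Context {F : fieldType} {L : fieldExtType F}.
Context {nu : valuation F} {nuL : valuation L} {p : nat}.
Hypothesis (pcharF : p \in [pchar F]) (nuL_ext : extends nu nuL).
Context {z : L} {B : rat}.
Hypothesis z_gt : forall c : F, z != c%:A /\ nuL (z - c%:A) < B.
Hypothesis z_sup : forall b : rat, b < B -> exists c : F, b < nuL (z - c%:A).
Local Notation "f ^%:A" := (map_poly (in_alg L) f)
  (at level 2, format "f ^%:A") : ring_scope.

(** The margin e is uniform in c: strict domination for each c separately would not let a Newton
    step cross the bound B. *)
Definition taylor_dominated (f : {poly F}) : Prop :=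
  f^%:A.[z] != 0 /\ exists b e : rat, [/\ b < B, 0 < e &
    forall (c : F) i, b <= nuL (z - c%:A) ->
    val_ge nuL (nuL f^%:A.[z] + e) (f^%:A^`N(i.+1).[z] * (z - c%:A) ^+ i.+1)].

Lemma alg_eq0 (c : F) : (c%:A == 0 :> L) = (c == 0).
Proof. by rewrite scaler_eq0 oner_eq0 orbF. Qed.

Lemma horner_algA (f : {poly F}) (c : F) : f^%:A.[c%:A] = f.[c]%:A.
Proof. exact: horner_map. Qed.

Lemma val_ge_subC g (a x y : L) n :
  val_ge nuL g (a * (x - y) ^+ n) = val_ge nuL g (a * (y - x) ^+ n).
Proof.
rewrite -[x - y]opprB exprNn mulrCA -signr_odd.
by case: (odd n); rewrite ?expr0 ?mul1r // expr1 mulN1r val_geN.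
Qed.

Lemma val_ge_taylor1 (g : {poly L}) (y : L) r :
  (forall i, val_ge nuL r (g^`N(i.+1).[z] * (z - y) ^+ i.+1)) ->
  val_ge nuL r (g.[y] - g.[z]).
Proof.
move=> hg; have zyC : GRing.comm z (y - z) by apply: mulrC.
rewrite -{1}[y](subrKC z) (nderiv_taylor_wide zyC (leqnSn _)).
rewrite big_ord_recl nderivn0 expr0 mulr1 addrAC subrr add0r.
by apply: val_ge_sum => i _; rewrite val_ge_subC; apply: hg.
Qed.

Lemma val_ge_taylor2 (g : {poly L}) (y : L) r :
  (forall i, val_ge nuL r (g^`N(i.+2).[z] * (z - y) ^+ i.+2)) ->
  val_ge nuL r (g.[y] - g.[z] - g^`().[z] * (y - z)).
Proof.
move=> hg; have zyC : GRing.comm z (y - z) by apply: mulrC.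
rewrite -{1}[y](subrKC z) (nderiv_taylor_wide (n := (size g).+2) zyC).
  rewrite !big_ord_recl nderivn0 expr0 mulr1 nderivn1 expr1.
  rewrite [X in val_ge _ _ (X - _)]addrAC subrr add0r addrAC subrr add0r.
  by apply: val_ge_sum => i _; rewrite val_ge_subC; apply: hg.
exact: leqW (leqnSn _).
Qed.

(** In the Taylor expansion at z the constant term dominates, so f(c) and f(z) have the same value
    and their quotient has residue 1. *)
Lemma taylor_dominated_approx f : taylor_dominated f ->
  exists2 b : rat, b < B & forall c : F, b <= nuL (z - c%:A) ->
    f.[c] != 0 /\ val_gt nuL (nuL f.[c]%:A) (f^%:A.[z] - f.[c]%:A).
Proof.
move=> [fz0 [b [e [bB e0 hf]]]]; exists b => // c hc.
have key : val_gt nuL (nuL f^%:A.[z]) (f.[c]%:A - f^%:A.[z]).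
  apply: (@val_ge_gt _ _ (nuL f^%:A.[z] + e)); first by rewrite ltrDl.
  by rewrite -horner_algA val_ge_taylor1 // => i; apply: hf.
have [] := val_add_dominant fz0 key; rewrite subrKC alg_eq0 => fc0 ->.
by split=> //; rewrite -val_gtN opprB.
Qed.

(** Induction on the degree, through f'. With w = f'(z), the induction hypothesis bounds all terms
    of order at least 2 by nu(w) + e + nu(z - c). If nu(f(z)) < nu(w) + B, the linear term is
    dominated too once c is close to z. Otherwise a Newton step would produce an element of F at
    distance at least B from z, which [z_gt] forbids. *)
Lemma taylor_dominated_lt (f : {poly F}) :
  f != 0 -> (size f <= p)%N -> taylor_dominated f.
Proof.
have [n] := ubnP (size f); elim: n f => // n IH f /ltnSE size_n f0 size_p.
have [/size1_polyC fC|size_gt1] := leqP (size f) 1.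
  move: f0; rewrite fC polyC_eq0 => c0.
  split; first by rewrite map_polyC /= hornerC alg_eq0.
  exists (B - 1), 1; split=> // [|c i _]; first by rewrite ltrBlDr ltrDl.
  by rewrite map_polyC nderivnC /= horner0 mul0r val_ge0.
have unitn i : (i < size f)%N -> (0 < i)%N -> i%:R != 0 :> F.
  move=> i_lt i_gt0; rewrite -(dvdn_pcharf pcharF) gtnNdvd //.
  exact: leq_trans i_lt size_p.
have pcharL : p \in [pchar L].
  by rewrite (rmorph_pchar (in_alg L)).
have valn i : (i < size f)%N -> (0 < i)%N ->
    i%:R != 0 :> L /\ nuL i%:R = 0.
  move=> i_lt i_gt0; have h : i%:R != 0 :> L.
    by have := unitn i i_lt i_gt0; rewrite -alg_eq0 /= -(rmorph_nat (in_alg L)).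
  by split=> //; rewrite (val_nat_pchar pcharL).
(* The leading coefficient of f is multiplied by deg f, which is invertible because 0 < deg f <
   p. *)
have f'0 : f^`() != 0.
  apply/eqP => /(congr1 (fun g : {poly F} => g`_(size f).-2)).
  rewrite coef_deriv coef0 => /eqP.
  have -> : ((size f).-2.+1 = (size f).-1)%N by case: (size f) size_gt1 => [|[]].
  rewrite -mulr_natr mulf_eq0 -lead_coefE lead_coef_eq0 (negPf f0) /=.
  by apply/negP; apply: unitn; case: (size f) size_gt1 => [|[]].
have size' : (size f^`() < size f)%N by apply: lt_size_deriv.
have [||f'z0 [b [e [bB e0 hf']]]] := IH f^`() _ f'0.
- exact: leq_trans size' size_n.
- by apply: ltnW; apply: leq_trans size' size_p.
set w := f^%:A^`().[z]; have wE : f^`()^%:A.[z] = w by rewrite -deriv_map.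
rewrite wE in f'z0 hf'.
(* The Taylor coefficient of f' of index i+1 is i+2 times that of f of index i+2. The factor i+2 has
   value 0 when i+2 <= deg f; beyond the degree the coefficient vanishes. *)
have higher c i : b <= nuL (z - c%:A) ->
    val_ge nuL (nuL w + e) (f^%:A^`N(i.+2).[z] * (z - c%:A) ^+ i.+1).
  move=> hc; have := hf' c i hc; rewrite -deriv_map deriv_nderivn hornerMn.
  have [i_lt|i_ge] := ltnP i.+2 (size f); last first.
    rewrite (_ : _^`N(i.+2) = 0) ?horner0 ?mul0r ?val_ge0 //.
    apply/polyP => j; rewrite coef_nderivn coef0 nth_default ?mul0rn //.
    by rewrite size_map_poly (leq_trans i_ge) ?leq_addr.
  have [n0 vn] := valn _ i_lt isT.
  rewrite -mulr_natr mulrAC /val_ge !mulf_eq0 (negPf n0) orbF.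
  case: eqP => //= /eqP h1; case: eqP => //= /eqP h2.
  by rewrite [nuL (_ * _%:R)]val_funM ?mulf_neq0 // vn addr0.
have higherM c i : b <= nuL (z - c%:A) ->
    val_ge nuL (nuL w + e + nuL (z - c%:A))
      (f^%:A^`N(i.+2).[z] * (z - c%:A) ^+ i.+2).
  move=> hc; rewrite (exprSr _ i.+1) mulrA.
  by apply: val_geM; rewrite ?higher ?val_ge_val.
have zc0 c : z - c%:A != 0 by rewrite subr_eq0 (z_gt c).1.
case: (boolP (val_ge nuL (nuL w + B) f^%:A.[z])) => [fz_ge|]; last first.
  rewrite /val_ge negb_or -ltNge => /andP[fz0 fz_lt]; split=> //.
  (* The new threshold is nu(z - c1), with c1 so close to z that the linear term w (z - c1) has
     larger value than f(z); the excess is the new margin. *)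
  have : Num.max b (nuL f^%:A.[z] - nuL w) < B by rewrite gt_max bB ltrBlDl.
  move=> /z_sup[c1]; rewrite gt_max => /andP[b_lt lt1].
  exists (nuL (z - c1%:A)), (nuL w + nuL (z - c1%:A) - nuL f^%:A.[z]).
  split=> [||c i hc]; [exact: (z_gt c1).2|lra|].
  case: i => [|i].
    rewrite nderivn1 expr1 -/w /val_ge val_funM //.
    by apply/orP; right; lra.
  by apply: val_ge_le (higherM c i _); lra.
(* From nu(z - c) > B - e, the terms of order at least 2 have value at least nu(w) + B. *)
have : Num.max b (B - e) < B by rewrite gt_max bB ltrBlDr ltrDl.
move=> /z_sup[c]; rewrite gt_max => /andP[/ltW hc ltc].
have f'c_near : val_ge nuL (nuL w + e) (f^`().[c]%:A - w).
  rewrite -horner_algA -wE val_ge_taylor1 // => i; rewrite wE; exact: hf'.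
have [f'c0 f'cE] : f^`().[c]%:A != 0 :> L /\ nuL f^`().[c]%:A = nuL w.
  have := @val_add_dominant _ nuL w (f^`().[c]%:A - w) f'z0; rewrite subrKC.
  by apply; apply: val_ge_gt f'c_near; rewrite ltrDl.
exfalso.
(* Newton's step from c lands within B of z: nuL (z - c') >= B.            *)
pose c' := c - f.[c] / f^`().[c].
have := (z_gt c').2; apply/negP; rewrite -leNgt.
suff : val_ge nuL B (z - c'%:A) by rewrite /val_ge (negPf (zc0 c')).
(* This element is the sum of f(z), of (f'(c) - w)(z - c) and of the second-order remainder of f at
   z, each of value at least nu(w) + B. *)
have step : val_ge nuL (nuL w + B) (f.[c]%:A - f^`().[c]%:A * (c%:A - z)).
  have wz : nuL w + B <= nuL w + e + nuL (z - c%:A) by lra.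
  have h2 := @val_ge_taylor2 f^%:A c%:A _ (fun i => val_ge_le wz (higherM c i hc)).
  have h1 : val_ge nuL (nuL w + B) ((f^`().[c]%:A - w) * (z - c%:A)).
    exact: val_ge_le wz (val_geM f'c_near (val_ge_val _)).
  have := val_geD fz_ge (val_geD h1 h2); rewrite -/w horner_algA.
  by congr (val_ge _ _ _); ring.
have -> : z - c'%:A = (f.[c]%:A - f^`().[c]%:A * (c%:A - z)) * f^`().[c]%:A^-1.
  rewrite /c' scalerBl mulrBl mulrAC mulfV // mul1r -[(_ / _)%:A]/(in_alg L _).
  by rewrite rmorphM fmorphV /=; ring.
have -> : B = nuL w + B - nuL f^`().[c]%:A by rewrite f'cE addrAC subrr add0r.
apply: val_geM step _.
by rewrite /val_ge val_funV // lexx orbT.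
Qed.
Lemma generator_poly : <<1; z>>%VS = {:L}%VS -> \dim {:L} = p ->
  forall y : L, y != 0 ->
  exists2 f : {poly F}, f^%:A.[z] = y & f != 0 /\ (size f <= p)%N.
Proof.
move=> z_gen dimL y y0.
have yz : y \in <<1; z>>%VS by rewrite z_gen memvf.
have /polyOver1P[f fE] := Fadjoin_polyOver 1%AS z y.
have fz : f^%:A.[z] = y by rewrite -fE Fadjoin_poly_eq.
exists f => //; split.
  by apply: contra_neq y0 => f0; rewrite -fz f0 rmorph0 horner0.
rewrite -(size_map_poly (in_alg L)) /= -fE (leq_trans (size_Fadjoin_poly _ _ _)) //.
by rewrite -dimL -z_gen dim_Fadjoin dimv1 muln1.
Qed.

(** By [taylor_dominated_lt] no nonzero polynomial of degree less than p vanishes at z, so a root of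
    a polynomial of degree p has degree exactly p. *)
Lemma generator_dim (g : {poly F}) : <<1; z>>%VS = {:L}%VS ->
  size g = p.+1 -> root g^%:A z -> \dim {:L} = p.
Proof.
move=> z_gen size_g gz; rewrite -z_gen dim_Fadjoin dimv1 muln1.
have /polyOver1P[m mE] := minPolyOver 1%AS z.
have size_m : size m = (adjoin_degree 1%AS z).+1.
  by rewrite -(size_map_poly (in_alg L)) /= -mE size_minPoly.
have m0 : m != 0 by rewrite -size_poly_eq0 size_m.
have g0 : g != 0 by rewrite -size_poly_eq0 size_g.
apply/eqP; rewrite eqn_leq; apply/andP; split.
  rewrite -ltnS -size_g -size_m -!(size_map_poly (in_alg L)) /= -mE.
  rewrite dvdp_leq ?map_poly_eq0 // minPoly_dvdp //.
  by apply/polyOver1P; exists g.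
rewrite leqNgt -size_m; apply/negP => /(taylor_dominated_lt m m0)[+ _].
by rewrite -mE minPolyxx eqxx.
Qed.

Hypotheses (z_gen : <<1; z>>%VS = {:L}%VS) (dimL : \dim {:L} = p).

(** Each nonzero y is f(z) with deg f < p, hence is approximated by some f(c) in F with the same
    value and, for value 0, the same residue. *)
Lemma generator_immediate : immediate nu nuL.
Proof.
have approx (y : L) : y != 0 -> exists2 c : F, c != 0 &
    nuL y = nu c /\ val_gt nuL (nu c) (y - c%:A).
  move=> /(generator_poly z_gen dimL)[f fz [f0 size_f]].
  have [b bB hb] := taylor_dominated_approx _ (taylor_dominated_lt f f0 size_f).
  have [c /ltW /hb[fc0]] := z_sup _ bB; rewrite fz => h.
  exists f.[c] => //; rewrite -(nuL_ext _ fc0); split=> //.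
  have fc0L : f.[c]%:A != 0 :> L by rewrite alg_eq0.
  by have [_] := val_add_dominant fc0L h; rewrite subrKC.
split=> // [g|y].
  split=> [[y /approx[c c0 [-> _]] <-]|[c c0 <-]]; first by exists c.
  by exists c%:A; rewrite ?alg_eq0 ?nuL_ext.
rewrite -[y]residue_repr; set x := val _.
have hx : val_ge nuL 0 x by apply: valP.
have [x0|x0] := eqVneq x 0.
  exists (residue nu 0); rewrite residue_embE ?val_ge0 //.
  by rewrite x0 scale0r.
have [c c0 [xc hc]] := approx _ x0.
have c_ge0 : 0 <= nu c by move: hx; rewrite /val_ge (negPf x0) xc.
have hcF : val_ge nu 0 c by rewrite /val_ge c_ge0 orbT.
exists (residue nu c); rewrite residue_embE //; apply/eqP.
rewrite eq_sym residueE //; first exact: val_gt_le c_ge0 hc.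
by rewrite /val_ge nuL_ext // c_ge0 orbT.
Qed.

End NewtonApproximation.

(** The value of f(z) is nu(f(c)) for every c close enough to z, and closeness is measured by the
    values at z - c, on which all extensions agree. *)
Lemma generator_unique_extension (F : fieldType) (L : fieldExtType F)
    (nu : valuation F) (nuL : valuation L) (p : nat) (z : L) (B : rat) :
  p \in [pchar F] -> <<1; z>>%VS = {:L}%VS -> \dim {:L} = p ->
  extends nu nuL ->
  (forall nuL' : valuation L, extends nu nuL' ->
     forall c : F, nuL' (z - c%:A) = nuL (z - c%:A)) ->
  (forall c : F, z != c%:A /\ nuL (z - c%:A) < B) ->
  (forall b : rat, b < B -> exists c : F, b < nuL (z - c%:A)) ->
  unique_extension nu nuL.
Proof.
move=> pF z_gen dimL ext same z_gt z_sup; split=> // nuL' ext' y.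
move=> /(generator_poly z_gen dimL)[f <- [f0 size_f]].
have value_at (nuM : valuation L) : extends nu nuM ->
    (forall c : F, nuM (z - c%:A) = nuL (z - c%:A)) ->
    exists2 b : rat, b < B & forall c : F, b <= nuL (z - c%:A) ->
      nuM (map_poly (in_alg L) f).[z] = nu f.[c].
  move=> extM eqM.
  have gtM c : z != c%:A /\ nuM (z - c%:A) < B by rewrite eqM.
  have supM b : b < B -> exists c : F, b < nuM (z - c%:A).
    by move=> /z_sup[c hc]; exists c; rewrite eqM.
  have [b bB hb] := taylor_dominated_approx (nuL := nuM) _
    (taylor_dominated_lt pF gtM supM f f0 size_f).
  exists b => // c; rewrite -eqM => /hb[fc0]; rewrite -(extM _ fc0) => h.
  have fc0L : f.[c]%:A != 0 :> L by rewrite alg_eq0.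
  by have [_] := val_add_dominant fc0L h; rewrite subrKC.
have [b1 b1B h1] := value_at nuL' ext' (same _ ext').
have [b2 b2B h2] := value_at nuL ext (fun=> erefl).
have /z_sup[c] : Num.max b1 b2 < B by rewrite gt_max b1B.
by rewrite gt_max => /andP[/ltW/h1 -> /ltW/h2 ->].
Qed.

Lemma residue_emb_inj (F : fieldType) (L : fieldExtType F)
    (nu : valuation F) (nuL : valuation L) :
  extends nu nuL -> injective (residue_emb (nuF := nu) nuL).
Proof.
move=> ext c d; rewrite -[c]residue_repr -[d]residue_repr.
set x := val (repr c); set y := val (repr d).
have hx : val_ge nu 0 x by apply: valP.
have hy : val_ge nu 0 y by apply: valP.
have geA z : val_ge nu 0 z -> val_ge nuL 0 z%:A.
  by rewrite /val_ge alg_eq0; have [//|z0] := eqVneq z 0; rewrite ext.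
rewrite !residue_embE // => /eqP; rewrite residueE ?geA // => h.
apply/eqP; rewrite residueE //; move: h; rewrite -scalerBl /val_gt alg_eq0.
by have [//|z0] := eqVneq (x - y) 0; rewrite ext.
Qed.

Lemma immediate_defect_extension (F : fieldType) (L : fieldExtType F)
    (nu : valuation F) (nuL : valuation L) (p : nat) :
  p \in [pchar F] -> \dim {:L} = p -> immediate nu nuL ->
  unique_extension nu nuL -> defect_extension nu nuL.
Proof.
move=> pF dimL [ext groupE residue_surj] uniq.
have p_pr := pcharf_prime pF.
exists p; last exact: prime_gt1.
split=> //.
  rewrite pnatE // inE p_pr /=; apply/eqP.
  have valp0 : p%:R = 0 :> val_ring nu.
    by apply: val_inj; rewrite rmorph_nat rmorph0 pcharf0.
  rewrite -[LHS](rmorph_nat (\pi_{ideal_quot (@val_max_ideal _ nu)})%qT) valp0.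
  by rewrite rmorph0.
(* Immediacy gives e = f = 1, so the whole degree p is defect. *)
exists 1%N, 1%N; split; last by rewrite dimL !mul1n.
  exists (fun=> 0) => [_|g Lg].
    by exists 1; [exact: oner_neq0|exact: val_fun1].
  exists ord0; split; first by rewrite subr0; apply/groupE.
  by move=> i _; rewrite (ord1 i).
exists (fun=> 1) => y.
have [c cy] := residue_surj y; exists [ffun=> c]; split.
  by rewrite big_ord1 ffunE mulr1.
move=> c'; rewrite big_ord1 mulr1 => yE; apply/ffunP => i.
rewrite ffunE (ord1 i); apply: (residue_emb_inj _ _ _ _ ext).
by rewrite cy yE.
Qed.

(** * Purely inseparable extensions of degree p *)

Lemma det_pow_char_poly (F : fieldType) (p n : nat) (w : F) (C : 'M_n) :
  (0 < n)%N -> char_poly C %| 'X^p - w%:P -> \det C ^+ p = w ^+ n.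
Proof.
case: n C => // n C _ /dvdpP[h /(congr1 (horner_mx C))].
rewrite rmorphM /= Cayley_Hamilton mulr0 rmorphB rmorphXn /= horner_mx_X.
rewrite horner_mx_C => /eqP; rewrite subr_eq0 => /eqP Cp.
rewrite -(det_scalar n.+1 w) -Cp.
by elim: p {h Cp} => [|p IH]; rewrite ?expr0 ?det1 // !exprS detM IH.
Qed.

(* For a monic divisor f of X^p - w of degree d, the companion matrix C of f  *)
(* satisfies C^p = w, so (det C)^p = w^d, which makes w a p-th power when d   *)
(* is prime to p.                                                             *)
Lemma irreducible_Xp_subC (F : fieldType) (p : nat) (w : F) : prime p ->
  (forall c, c ^+ p != w) -> irreducible_poly ('X^p - w%:P).
Proof.
move=> p_pr w_npow; have p_gt0 := prime_gt0 p_pr.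
have q_size : size ('X^p - w%:P) = p.+1 by rewrite size_XnsubC.
split; first by rewrite q_size ltnS.
move=> f f_size f_dvd.
have q0 : 'X^p - w%:P != 0 by rewrite -size_poly_eq0 q_size.
have f0 : f != 0 by apply: dvdpN0 f_dvd q0.
rewrite -dvdp_size_eqp // q_size.
have f_le : (size f <= p.+1)%N by rewrite -q_size dvdp_leq.
move: f_le; rewrite leq_eqVlt => /orP[//|f_lt]; exfalso.
pose g := (lead_coef f)^-1 *: f.
have lf0 : lead_coef f != 0 by rewrite lead_coef_eq0.
have g_monic : g \is monic by rewrite monicE lead_coefZ mulVf.
have g_size : size g = size f by rewrite size_scale ?invr_eq0.
have f_gt1 : (1 < size f)%N by rewrite ltn_neqAle eq_sym f_size size_poly_gt0.
have dE : exists d, (size g).-1 = d.+1.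
  by exists (size g).-2; rewrite g_size; case: (size f) f_gt1 => [|[]].
have g_dvd : g %| 'X^p - w%:P by rewrite dvdpZl ?invr_eq0.
have det_pow : (\det (companionmx g)) ^+ p = w ^+ (size g).-1.
  have [d dE'] := dE; apply: det_pow_char_poly; first by rewrite dE'.
  by rewrite companionmxK.
have cop : coprime (size g).-1 p.
  rewrite coprime_sym prime_coprime // gtnNdvd // g_size.
  - by case: (size f) f_gt1 => [|[]].
  - by case: (size f) f_gt1 f_lt => [|[]].
(* With d u = v p + 1 for d the degree of g, the p-th power of (det C)^u / w^v is w^(d u - v p) =
   w. *)
have [[u v] /= uv] : exists uv : nat * nat, ((size g).-1 * uv.1 = uv.2 * p + 1)%N.
  have [|u v uv _] := @egcdnP (size g).-1 p; first by have [d ->] := dE.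
  by exists (u, v); rewrite /= mulnC uv (eqP cop).
have w0 : w != 0.
  by apply/eqP => w0; have := w_npow 0; rewrite w0 expr0n gtn_eqF ?eqxx.
have := w_npow (\det (companionmx g) ^+ u / w ^+ v); rewrite expr_div_n.
rewrite -exprM mulnC exprM det_pow -exprM uv exprD expr1 -exprM mulrAC mulfV.
  by rewrite mul1r eqxx.
by rewrite expf_neq0.
Qed.

Lemma exists_root_ext (F : fieldType) (p : nat) (w : F) : prime p ->
  (forall c, c ^+ p != w) ->
  exists (E : fieldExtType F) (eta : E),
    [/\ \dim {:E} = p, <<1; eta>>%VS = {:E}%VS & eta ^+ p = w%:A].
Proof.
move=> p_pr /(irreducible_Xp_subC _ _ _ p_pr)/irredp_FAdjoin[E dimE [eta root_eta gen]].
exists E, eta; split=> //; first by rewrite dimE size_XnsubC ?prime_gt0.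
move: root_eta; rewrite rmorphB /= map_polyXn map_polyC /= rootE.
by rewrite !hornerE subr_eq0 => /eqP.
Qed.

Section PurelyInseparable.
Context {F : fieldType} {E : fieldExtType F} {p : nat} {w : F} {eta : E}.
Hypotheses (pcharF : p \in [pchar F]) (gen : <<1; eta>>%VS = {:E}%VS).
Hypothesis (eta_pow : eta ^+ p = w%:A).

(** If y = g(eta), Frobenius turns y^p into a polynomial with coefficients in F evaluated at eta^p =
    w. The boolean equality serves [xchoose]. *)
Lemma exists_pth_power (y : E) : exists a : F, y ^+ p == a%:A.
Proof.
have : y \in <<1; eta>>%VS by rewrite gen memvf.
move=> /Fadjoin_polyP[f /polyOver1P[g ->] ->].
have pcharE : p \in [pchar E] by rewrite (rmorph_pchar (in_alg E)).
have : (map_poly (in_alg E) g).[eta] ^+ p \in 1%VS; last first.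
  by move=> /vlineP[a ->]; exists a.
rewrite -(pFrobenius_autE pcharE) -horner_map.
rewrite rpred_horner ?polyOverP // /= ?pFrobenius_autE; last first.
  by rewrite eta_pow rpredZ ?rpred1.
apply/polyOverP => i; rewrite !coef_map /= pFrobenius_autE.
by rewrite rpredX // rpredZ // rpred1.
Qed.

Lemma purely_inseparable_root : purely_inseparable 1 {:E}.
Proof.
apply/purely_inseparableP => y _; apply/purely_inseparable_elementP_pchar.
exists p; last by have [a /eqP ->] := exists_pth_power y; rewrite rpredZ ?rpred1.
rewrite pnatE ?(pcharf_prime pcharF) //.
by rewrite (rmorph_pchar (in_alg E)).
Qed.

Definition pth_power (y : E) : F := xchoose (exists_pth_power y).

Lemma pth_powerE y : (pth_power y)%:A = y ^+ p.
Proof. by have /eqP := xchooseP (exists_pth_power y). Qed.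

Lemma pth_power_eq0 y : (pth_power y == 0) = (y == 0).
Proof.
by rewrite -(alg_eq0 (L := E)) pth_powerE expf_eq0 prime_gt0 ?(pcharf_prime pcharF).
Qed.

Context (nu : valuation F).

(** The only candidate for an extension of nu, as p nu(y) = nu(y^p). It is a valuation because
    Frobenius is an injective ring morphism. *)
Definition root_val_fun (y : E) : rat := nu (pth_power y) / p%:R.

Lemma root_val_funM (x y : E) : x != 0 -> y != 0 ->
  root_val_fun (x * y) = root_val_fun x + root_val_fun y.
Proof.
move=> x0 y0; rewrite /root_val_fun -mulrDl; congr (_ / _).
rewrite -val_funM ?pth_power_eq0 //; congr (nu _).
by apply: (fmorph_inj (in_alg E)); rewrite rmorphM /= !pth_powerE exprMn.
Qed.

Lemma root_val_funD (x y : E) : x != 0 -> y != 0 -> x + y != 0 ->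
  Num.min (root_val_fun x) (root_val_fun y) <= root_val_fun (x + y).
Proof.
move=> x0 y0 xy0; rewrite /root_val_fun -minr_pMl ?invr_ge0 ?ler0n //.
rewrite ler_wpM2r ?invr_ge0 ?ler0n //.
have powD : pth_power (x + y) = pth_power x + pth_power y.
  apply: (fmorph_inj (in_alg E)); rewrite rmorphD /= !pth_powerE.
  rewrite exprDn_pchar // pnatE ?(pcharf_prime pcharF) //.
  by rewrite (rmorph_pchar (in_alg E)).
rewrite powD; have := xy0; rewrite -pth_power_eq0 powD => D0.
by apply: val_funD; rewrite ?pth_power_eq0.
Qed.

Definition root_valuation : valuation E :=
  Valuation root_val_funM root_val_funD.

Lemma root_valuation_pow (y : E) (a : F) : y ^+ p = a%:A ->
  root_valuation y = nu a / p%:R.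
Proof.
rewrite /= /root_val_fun -pth_powerE => /(fmorph_inj (in_alg E)) ya.
by congr (nu _ / _).
Qed.

Lemma root_valuation_extends : extends nu root_valuation.
Proof.
move=> c c0; rewrite (root_valuation_pow _ (c ^+ p)); last first.
  by rewrite -[_%:A]/(in_alg E _) -rmorphXn.
have p0 : p%:R != 0 :> rat by rewrite pnatr_eq0 -lt0n prime_gt0 ?(pcharf_prime pcharF).
by rewrite val_funX // -[nu c *+ p]mulr_natr mulfK.
Qed.

End PurelyInseparable.

(** * The derivative with respect to u *)

(* In {poly {poly k}} the inner variable 'Y is u and the outer variable 'X is *)
(* v, so this is the partial derivative with respect to u.                    *)
Definition deriv_inner (R : nzRingType) (A : {poly {poly R}}) : {poly {poly R}} :=
  swapXY (swapXY A)^`().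
Arguments deriv_inner {R} A.

Section DerivInner.
Context {R : comNzRingType}.
Implicit Types A B : {poly {poly R}}.

Lemma deriv_innerD A B : deriv_inner (A + B) = deriv_inner A + deriv_inner B.
Proof. by rewrite /deriv_inner !(rmorphD, derivD). Qed.

Lemma deriv_innerN A : deriv_inner (- A) = - deriv_inner A.
Proof. by rewrite /deriv_inner !(rmorphN, derivN). Qed.

Lemma deriv_innerM A B :
  deriv_inner (A * B) = deriv_inner A * B + A * deriv_inner B.
Proof. by rewrite /deriv_inner rmorphM derivM rmorphD !rmorphM /= !swapXYK. Qed.

Lemma deriv_innerX : deriv_inner ('X : {poly {poly R}}) = 0.
Proof. by rewrite /deriv_inner swapXY_X derivC rmorph0. Qed.

Lemma deriv_innerY : deriv_inner ('Y : {poly {poly R}}) = 1.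
Proof. by rewrite /deriv_inner swapXY_Y derivX rmorph1. Qed.

Lemma deriv_inner_pchar A p n : p \in [pchar R] -> (p %| n)%N ->
  deriv_inner (A ^+ n) = 0.
Proof.
move=> pR /dvdnP[m ->]; rewrite /deriv_inner rmorphXn deriv_exp.
rewrite mulrnA -mulr_natr -!polyC_natr (pcharf0 pR) !polyC0.
by rewrite mulr0 rmorph0.
Qed.

End DerivInner.

Section DerivativeBound.
Context {k : fieldType} {nu : valuation (ratfun2 k)} {G : rat}.
Hypotheses (centered : centered_in_local_ring_uv nu) (G_gt0 : 0 < G).
Implicit Types A B : {poly {poly k}}.

Lemma local_ring_tofrac A : local_ring_uv (tofrac A).
Proof. by exists A, 1; rewrite !hornerC oner_neq0 rmorph1 divr1. Qed.

Lemma val_ge_tofrac A : val_ge nu 0 (tofrac A).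
Proof. exact: (centered _ (local_ring_tofrac A)).1. Qed.

Lemma val_ge_tofracV A : A.[0].[0] != 0 -> val_ge nu 0 (tofrac A)^-1.
Proof.
move=> A0; apply: (centered _ _).1.
by exists 1, A; rewrite rmorph1 div1r.
Qed.

Lemma tofrac_unit_neq0 A : A.[0].[0] != 0 -> tofrac A != 0.
Proof. by apply: contra_neq => /eqP; rewrite tofrac_eq0 => /eqP ->; rewrite !horner0. Qed.

(** Only polynomials are differentiated: B is a unit of the local ring, so bounding the derivative
    of the numerator is enough. The level g is a lower bound for nu(f) and not its exact value,
    which makes the property stable under sums. *)
Definition deriv_bounded (g : rat) (f : ratfun2 k) : Prop :=
  exists A B, [/\ B.[0].[0] != 0, f = tofrac A / tofrac B, val_ge nu g f &
    val_gt nu (g - G) (tofrac (deriv_inner A))].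

Lemma deriv_bounded0 g : deriv_bounded g 0.
Proof.
exists 0, 1; rewrite !hornerC oner_neq0 rmorph0 mul0r val_ge0; split=> //.
by rewrite /deriv_inner !rmorph0 linear0 !rmorph0 val_gt0.
Qed.

Lemma deriv_bounded_le {g h f} : h <= g -> deriv_bounded g f -> deriv_bounded h f.
Proof.
move=> hg [A [B [B0 fE fg Ag]]]; exists A, B; split=> //.
  exact: val_ge_le fg.
by apply: val_gt_le Ag; rewrite lerD2r.
Qed.

Lemma deriv_bounded_local f : local_ring_uv f -> deriv_bounded 0 f.
Proof.
move=> Rf; have [A [B [B0 fE]]] := Rf; exists A, B; split=> //.
  exact: (centered _ Rf).1.
by apply: val_ge_gt (val_ge_tofrac _); rewrite sub0r oppr_lt0.
Qed.

Lemma val_ge_num {g f A B} : B.[0].[0] != 0 -> f = tofrac A / tofrac B ->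
  val_ge nu g f -> val_ge nu g (tofrac A).
Proof.
move=> B0 fE fg; rewrite -[g]addr0.
have -> : tofrac A = f * tofrac B by rewrite fE divfK ?tofrac_unit_neq0.
exact: val_geM fg (val_ge_tofrac B).
Qed.

Lemma deriv_boundedM g h f1 f2 : deriv_bounded g f1 -> deriv_bounded h f2 ->
  deriv_bounded (g + h) (f1 * f2).
Proof.
move=> [A [B [B0 fE fg Ag]]] [A' [B' [B'0 fE' fh Ah]]].
exists (A * A'), (B * B'); split; first by rewrite !hornerM mulf_neq0.
- by rewrite fE fE' !rmorphM /= mulf_div.
- exact: val_geM.
rewrite deriv_innerM rmorphD !rmorphM /= val_gtD //.
  have := val_ge_gtM (val_ge_num B'0 fE' fh) Ag.
  by congr (val_gt _ _ _); ring.
have := val_ge_gtM (val_ge_num B0 fE fg) Ah.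
by congr (val_gt _ _ _); ring.
Qed.

Lemma deriv_boundedD g f1 f2 : deriv_bounded g f1 -> deriv_bounded g f2 ->
  deriv_bounded g (f1 + f2).
Proof.
(* Passing to a common denominator adds A times a derivative, of value at least g > g - G. *)
have half A B A' B' f : B.[0].[0] != 0 -> f = tofrac A / tofrac B ->
    val_ge nu g f -> val_gt nu (g - G) (tofrac (deriv_inner A)) ->
    val_gt nu (g - G) (tofrac (deriv_inner (A * B'))).
  move=> B0 fE fg Ag; rewrite deriv_innerM rmorphD !rmorphM /= val_gtD //.
    by have := val_ge_gtM (val_ge_tofrac B') Ag; rewrite add0r mulrC.
  have := val_geM (val_ge_num B0 fE fg) (val_ge_tofrac (deriv_inner B')).
  by apply: val_ge_gt; rewrite addr0 ltrBlDr ltrDl.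
move=> [A [B [B0 fE fg Ag]]] [A' [B' [B'0 fE' fh Ah]]].
exists (A * B' + A' * B), (B * B'); split; first by rewrite !hornerM mulf_neq0.
- by rewrite fE fE' rmorphD !rmorphM /= addf_div ?tofrac_unit_neq0.
- exact: val_geD.
rewrite deriv_innerD rmorphD val_gtD //; first exact: half B0 fE fg Ag.
exact: half B'0 fE' fh Ah.
Qed.

(** An element f is a combination over the local ring of monomials in the P_i of value at least
    nu(f). The bound passes to monomials by the Leibniz rule, and coefficients satisfy it at level 0
    since G > 0. *)
Lemma generating_deriv_bounded (P : nat -> ratfun2 k) :
  generating_sequence (@local_ring_uv k) nu P ->
  (forall i, deriv_bounded (nu (P i)) (P i)) ->
  forall f, local_ring_uv f -> f != 0 -> deriv_bounded (nu f) f.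
Proof.
move=> [_ gen] hP f Rf f0.
have fI : valuation_ideal (@local_ring_uv k) nu (nu f) f.
  by split=> //; exact: val_ge_val.
have gf : exists h, [/\ local_ring_uv h, h != 0 & nu h = nu f] by exists f.
have := (gen _ gf f).1 fI; move: (nu f) => g [n [c [m [Rc mP ->]]]].
elim/big_ind: _ => [|x y|j _]; [exact: deriv_bounded0|exact: deriv_boundedD|].
have [a ga ->] := mP j; rewrite -[g]add0r.
apply: deriv_boundedM; first exact: deriv_bounded_local.
apply: deriv_bounded_le ga _; rewrite /monomial_value /monomial.
have one : deriv_bounded 0 1.
  by apply: deriv_bounded_local; rewrite -tofrac1; apply: local_ring_tofrac.
elim/big_ind2: _ => [//|x1 x2 y1 y2|i _]; first by move=> h1 h2; apply: deriv_boundedM.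
elim: (nth _ _ _) => [|e IH]; first by rewrite expr0 mulr0n.
by rewrite exprS mulrS; apply: deriv_boundedM.
Qed.

(** The witness may be another fraction N/B, but then N = A B; the term A times the derivative of B
    is harmless, and the unit B can be divided out. *)
Lemma deriv_bounded_tofrac A : deriv_bounded (nu (tofrac A)) (tofrac A) ->
  val_gt nu (nu (tofrac A) - G) (tofrac (deriv_inner A)).
Proof.
set g := nu _ => -[N [B [B0 AE Ag Ng]]].
have B0' := tofrac_unit_neq0 _ B0.
have NE : N = A * B.
  by apply/eqP; rewrite -tofrac_eq rmorphM /= AE divfK.
move: Ng; rewrite NE deriv_innerM rmorphD !rmorphM /= => Ng.
have AB : val_gt nu (g - G) (tofrac A * tofrac (deriv_inner B)).
  apply: val_ge_gt (val_geM Ag (val_ge_tofrac _)).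
  by rewrite addr0 ltrBlDr ltrDl.
have := val_ge_gtM (val_ge_tofracV _ B0) (val_gtB Ng AB).
by rewrite add0r addrK mulrC mulfK.
Qed.

End DerivativeBound.

(** * Distance of u and 1/u from the p-th powers *)

Lemma fraction_exists (R : idomainType) (c : {fraction R}) :
  exists n d : R, d != 0 /\ c = tofrac n / tofrac d.
Proof.
elim/quotW: c => x; have d0 : \d_x != 0 by apply: denom_ratioP.
exists \n_x, \d_x; split=> //; have Td0 : tofrac \d_x != 0 by rewrite tofrac_eq0.
apply: (canRL (mulfK Td0)); unlock tofrac; rewrite -[LHS]FracField.pi_mul.
apply/eqmodP; rewrite /= FracField.equivfE /FracField.mulf.
by rewrite !numden_Ratio ?(oner_neq0, mulf_neq0, mulr1, mulrA) // mulrC.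
Qed.

(** Subtracting the p-th power of d z^p / u^(p^e) from d^p y reproduces the recursion: y = P_(n-1)
    and z = P_n yield P_(n+1). *)
Lemma pth_power_approx_step (F : fieldType) (nu : valuation F) (p e : nat)
    (u c d y z : F) : p \in [pchar F] -> u != 0 -> nu u = 1 -> d != 0 ->
  u - c ^+ p = d ^+ p * y -> exists c' d' : F,
    [/\ d' != 0, u - c' ^+ p = d' ^+ p * (z ^+ (p ^ 2) - u ^+ (p ^ e.+1) * y) &
        nu (d' ^+ p) = nu (d ^+ p) - (p ^ e.+1)%:R].
Proof.
move=> pF u0 nu_u d0 cd.
have pnat : [pchar F].-nat p by rewrite pnatE // (pcharf_prime pF).
have uX0 j : u ^+ j != 0 by rewrite expf_neq0.
exists (c + d * z ^+ p / u ^+ (p ^ e)), (- (d / u ^+ (p ^ e))); split.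
- by rewrite oppr_eq0 mulf_neq0 ?invr_eq0.
- rewrite exprDn_pchar // opprD addrA cd exprNn_pchar //.
  rewrite !expr_div_n exprMn -!exprM -expnSr mulnn.
  by field.
- rewrite exprNn_pchar // val_funN ?expf_neq0 ?mulf_neq0 ?invr_eq0 //.
  rewrite expr_div_n val_funM ?invr_eq0 ?expf_neq0 // val_funV ?expf_neq0 //.
  by rewrite -exprM -expnSr (val_funX _ (p ^ _)) // nu_u.
Qed.

Section InversePthPowers.
Context {F : fieldType} {nu : valuation F} {p : nat} {u : F} {G : rat}.
Hypotheses (p_gt0 : (0 < p)%N) (u_neq0 : u != 0) (nu_u : nu u = 1) (G_gt1 : 1 < G).

(** A value of at least G - 2 > -1 would force nu(c^p) = nu(1/u) = -1, and the factorization through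
    c^-p - u would then give nu(u - c^-p) >= G. *)
Lemma inv_sub_pth_power_lt :
  (forall c : F, u - c ^+ p != 0 /\ nu (u - c ^+ p) < G) ->
  forall c : F, u^-1 - c ^+ p != 0 /\ nu (u^-1 - c ^+ p) < G - 2.
Proof.
move=> u_lt c; have d_gt : -1 < G - 2 by have := G_gt1; lra.
have nu_uV : nu u^-1 = -1 by rewrite val_funV // nu_u.
have uV0 : u^-1 != 0 by rewrite invr_eq0.
have [->|c0] := eqVneq c 0.
  by rewrite expr0n gtn_eqF // subr0 nu_uV.
have cp0 : c ^+ p != 0 by rewrite expf_neq0.
have [s0 s_lt] := u_lt c^-1.
have E : u^-1 - c ^+ p = (c^-1 ^+ p - u) * (u^-1 * c ^+ p).
  by rewrite exprVn; field; rewrite u_neq0 cp0.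
have s0' : c^-1 ^+ p - u != 0 by rewrite -opprB oppr_eq0.
have x0 : u^-1 - c ^+ p != 0 by rewrite E !mulf_neq0.
split=> //; rewrite ltNge; apply/negP => ge.
have nu_cp : nu (c ^+ p) = -1.
  have h : val_gt nu (nu u^-1) (- (u^-1 - c ^+ p)).
    by rewrite val_gtN /val_gt nu_uV (lt_le_trans d_gt ge) orbT.
  have [_] := val_add_dominant uV0 h.
  by rewrite opprB subrKC nu_uV.
move: ge; rewrite E val_funM ?mulf_neq0 // val_funM // nu_uV nu_cp.
rewrite -[c^-1 ^+ p - u]opprB val_funN //; lra.
Qed.

Lemma inv_sub_pth_power_sup :
  (forall c : F, u - c ^+ p != 0) ->
  (forall b : rat, b < G -> exists c : F, b < nu (u - c ^+ p)) ->
  forall b : rat, b < G - 2 -> exists c : F, b < nu (u^-1 - c ^+ p).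
Proof.
move=> u_npow u_sup b b_lt.
have /u_sup[c] : Num.max (b + 2) 1 < G by rewrite gt_max G_gt1 andbT; lra.
rewrite gt_max => /andP[b_c c_gt1]; exists c^-1.
have s0 := u_npow c.
have [] := @val_add_dominant _ nu _ (- (u - c ^+ p)) u_neq0.
  by rewrite val_gtN /val_gt nu_u c_gt1 orbT.
rewrite opprB subrKC => cp0 nu_cp.
have -> : u^-1 - c^-1 ^+ p = - (u - c ^+ p) * (u^-1 * (c ^+ p)^-1).
  by rewrite exprVn; field; rewrite u_neq0 cp0.
rewrite val_funM ?oppr_eq0 ?mulf_neq0 ?invr_eq0 // val_funN //.
rewrite val_funM ?invr_eq0 // !val_funV // nu_u nu_cp nu_u; lra.
Qed.

End InversePthPowers.

Section GeneratingPolynomials.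
Context {k : fieldType} {p : nat} {nu : valuation (ratfun2 k)}.
Context {P : nat -> ratfun2 k}.
Hypotheses (pchark : p \in [pchar k]) (centered : centered_in_local_ring_uv nu).
Hypotheses (P_0 : P 0%N = ratfun2_u k) (P_1 : P 1%N = ratfun2_v k).
Hypothesis P_2 : P 2%N = ratfun2_v k ^+ (p ^ 2) - ratfun2_u k.
Hypothesis P_rec : forall i : nat, (2 <= i)%N ->
  P i.+1 = P i ^+ (p ^ 2) - ratfun2_u k ^+ (p ^ (2 * i - 2)) * P i.-1.
Hypothesis P_generating : generating_sequence (@local_ring_uv k) nu P.
Hypothesis nu_P0 : nu (P 0%N) = 1.
Hypothesis nu_P : forall i : nat, (1 <= i)%N ->
  nu (P i) = \sum_(0 <= j < i) (p%:R : rat) ^ ((4 * j)%:Z - (2 * i)%:Z).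
Local Notation K := (ratfun2 k).
Local Notation u := (ratfun2_u k).
Local Notation v := (ratfun2_v k).

Let q : rat := p%:R ^+ 2.

(* The supremum of nu(u - c^p) for c in K; it is not attained.                *)
Definition u_dist : rat := q ^+ 2 / (q ^+ 2 - 1).

Lemma p_prime : prime p. Proof. exact: pcharf_prime pchark. Qed.

Lemma pcharK : p \in [pchar K].
Proof.
rewrite (rmorph_pchar (@tofrac {poly {poly k}})) //.
by rewrite (rmorph_pchar (@polyC {poly k})) // (rmorph_pchar (@polyC k)).
Qed.

Lemma p_ge2 : 2 <= p%:R :> rat. Proof. by rewrite ler_nat prime_gt1 ?p_prime. Qed.

Lemma q_ge4 : 4 <= q. Proof. by have := p_ge2; rewrite /q; nra. Qed.

Lemma q2_ge16 : 16 <= q ^+ 2. Proof. by have := q_ge4; nra. Qed.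

Lemma q_neq0 n : q ^+ n != 0.
Proof. by rewrite expf_neq0 // gt_eqF //; have := q_ge4; lra. Qed.

Lemma q2B1_neq0 : q ^+ 2 - 1 != 0.
Proof. by rewrite gt_eqF //; have := q2_ge16; lra. Qed.

Lemma qX_gt0 n : 0 < q ^+ n.
Proof. by rewrite exprn_gt0 //; have := q_ge4; lra. Qed.

Lemma exp_pE n : (p%:R : rat) ^+ (2 * n) = q ^+ n.
Proof. by rewrite exprM. Qed.

(** A geometric sum of ratio p^4 = q^2. *)
Lemma nu_PE i : (1 <= i)%N -> nu (P i) = (q ^+ i - (q ^+ i)^-1) / (q ^+ 2 - 1).
Proof.
move=> i1; rewrite nu_P //; have p0 : (p%:R : rat) != 0 by have := p_ge2; lra.
have -> : \sum_(0 <= j < i) (p%:R : rat) ^ ((4 * j)%:Z - (2 * i)%:Z) =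
    (\sum_(j < i) (q ^+ 2) ^+ j) / q ^+ i.
  rewrite big_mkord mulr_suml; apply: eq_bigr => j _.
  rewrite expfzDr // -invr_expz; congr (_ / _); rewrite -exprnP ?exp_pE //.
  by rewrite -exprM -(exp_pE (2 * j)) mulnA.
have := subrX1 (q ^+ 2) i => h.
have -> : \sum_(j < i) (q ^+ 2) ^+ j = ((q ^+ 2) ^+ i - 1) / (q ^+ 2 - 1).
  by rewrite h mulrC mulKf ?q2B1_neq0.
rewrite -exprM mulnC exprM.
by field; rewrite q2B1_neq0 (q_neq0 i).
Qed.

Lemma u_neq0 : u != 0.
Proof. by rewrite /ratfun2_u tofrac_eq0 polyC_eq0 polyX_eq0. Qed.

Lemma nu_u : nu u = 1. Proof. by rewrite -P_0. Qed.

Lemma u_distE : u_dist = 1 + (q ^+ 2 - 1)^-1.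
Proof. by rewrite /u_dist; field; rewrite q2B1_neq0. Qed.

Lemma q2B1V_gt0 : 0 < (q ^+ 2 - 1)^-1.
Proof. by rewrite invr_gt0; have := q2_ge16; lra. Qed.

(** The derivative kills p-th powers, so that of P_(i+1) is -u^(p^(2i-2)) times that of P_(i-1).
    This adds q^(i-1) to the value, and q^(i-1) + q^(i-1)/(q^2-1) = q^(i+1)/(q^2-1). For i >= 1 the
    bound exceeds nu(P_i) - G by q^-i/(q^2-1). *)
Lemma P_poly i : exists2 A, P i = tofrac A &
  val_ge nu (q ^+ i / (q ^+ 2 - 1) - u_dist) (tofrac (deriv_inner A)).
Proof.
pose Q i := exists2 A, P i = tofrac A &
  val_ge nu (q ^+ i / (q ^+ 2 - 1) - u_dist) (tofrac (deriv_inner A)).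
rewrite -/(Q i).
have val1 : val_ge nu 0 1 by rewrite /val_ge val_fun1 lexx orbT.
have Q0 : Q 0%N.
  exists 'Y; first exact: P_0.
  rewrite deriv_innerY rmorph1; apply: val_ge_le val1.
  by rewrite u_distE expr0 mul1r; lra.
have Q1 : Q 1%N.
  by exists 'X; rewrite // deriv_innerX rmorph0 val_ge0.
have p2 : (p %| p ^ 2)%N by rewrite dvdn_exp.
have Q2 : Q 2%N.
  exists ('X ^+ (p ^ 2) - 'Y); first by rewrite P_2 rmorphB rmorphXn.
  rewrite deriv_innerD deriv_innerN deriv_innerY (deriv_inner_pchar _ _ _ pchark p2).
  rewrite add0r rmorphN rmorph1 val_geN.
  by apply: val_ge_le val1; rewrite /u_dist subrr.
elim: i {-2}i (leqnn i) => [|n IH] i; first by rewrite leqn0 => /eqP ->.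
case: i => [|[|[|i]]] lt_n; [exact: Q0|exact: Q1|exact: Q2|].
clear Q0 Q1 Q2.
have [A AE Ad] := IH i.+2 lt_n; have [A' AE' Ad'] := IH i.+1 (ltnW lt_n).
exists (A ^+ (p ^ 2) - 'Y ^+ (p ^ (2 * i.+2 - 2)) * A').
  rewrite P_rec // AE /= AE' rmorphB rmorphM !rmorphXn.
  by [].
have pdvd : (p %| p ^ (2 * i.+2 - 2))%N by rewrite dvdn_exp // mulnS.
rewrite deriv_innerD deriv_innerN deriv_innerM !(deriv_inner_pchar _ _ _ pchark) //.
rewrite add0r mul0r add0r rmorphN val_geN rmorphM rmorphXn /=.
have val_Y : val_ge nu (q ^+ i.+1) (tofrac 'Y ^+ (p ^ (2 * i.+2 - 2))).
  have -> : q ^+ i.+1 = nu (u ^+ (p ^ (2 * i.+2 - 2))); last exact: val_ge_val.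
  rewrite val_funX ?u_neq0 // nu_u natrX -exp_pE; congr (_ ^+ _).
  by rewrite !mulnS addKn.
apply: val_ge_le (val_geM val_Y Ad').
rewrite le_eqVlt; apply/orP; left; apply/eqP; rewrite addrA; congr (_ - _).
by rewrite !exprS; field; rewrite -?expr2 q2B1_neq0.
Qed.

Lemma u_dist_gt0 : 0 < u_dist.
Proof. by rewrite u_distE; have := q2B1V_gt0; lra. Qed.

Lemma P_deriv_bounded i : deriv_bounded (nu := nu) (G := u_dist) (nu (P i)) (P i).
Proof.
have [A AE Ad] := P_poly i; exists A, 1; rewrite !hornerC oner_neq0 rmorph1 divr1.
split=> //; first exact: val_ge_val.
(* Index 0 is separate: the closed form would give 0 there, whereas nu(P_0) = 1. *)
case: i AE Ad => [|i] AE Ad; last first.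
  apply: val_ge_gt Ad; rewrite ltrD2r nu_PE // ltr_pM2r ?q2B1V_gt0 //.
  by rewrite ltrBlDr ltrDl invr_gt0 qX_gt0.
have -> : A = 'Y by apply/eqP; rewrite -tofrac_eq -AE P_0.
rewrite deriv_innerY rmorph1 nu_P0 /val_gt oner_eq0 /= val_fun1 u_distE.
by have := q2B1V_gt0; lra.
Qed.

Lemma sub_pth_power_lt (c : K) : u - c ^+ p != 0 /\ nu (u - c ^+ p) < u_dist.
Proof.
have [n [d [d0 ->]]] := fraction_exists _ c.
have p_gt0 := prime_gt0 p_prime.
have Td0 : tofrac d != 0 :> K by rewrite tofrac_eq0.
have Tdp0 : tofrac d ^+ p != 0 :> K by rewrite expf_neq0.
pose A := 'Y * d ^+ p - n ^+ p.
have AE : tofrac A = (u - (tofrac n / tofrac d) ^+ p) * tofrac d ^+ p.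
  by rewrite rmorphB rmorphM !rmorphXn /= expr_div_n mulrBl divfK.
have dA : deriv_inner A = d ^+ p.
  rewrite deriv_innerD deriv_innerN deriv_innerM !(deriv_inner_pchar _ _ _ pchark) //.
  by rewrite deriv_innerY mulr0 addr0 mul1r subr0.
(* If A were 0, so would be its derivative d^p. *)
have A0 : A != 0.
  apply: contra_neq Td0 => A0; apply/eqP; rewrite tofrac_eq0.
  by move: dA; rewrite A0 /deriv_inner !rmorph0 linear0 rmorph0 => /esym/eqP;
    rewrite expf_eq0 p_gt0.
have TA0 : tofrac A != 0 :> K by rewrite tofrac_eq0.
have c0 : u - (tofrac n / tofrac d) ^+ p != 0.
  by apply: contra_neq TA0 => c0; rewrite AE c0 mul0r.
split=> //.
have := deriv_bounded_tofrac centered u_dist_gt0 A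
  (generating_deriv_bounded centered u_dist_gt0 P P_generating P_deriv_bounded
     _ (local_ring_tofrac A) TA0).
rewrite dA rmorphXn /val_gt (negPf Tdp0) /= AE val_funM //.
by rewrite addrAC gtrDr subr_lt0.
Qed.

(** Only even indices occur, since a step leads from P_(n-1) to P_(n+1). It starts from u - v^(p^2)
    = -P_2, and the step with n = 2m+3 lowers nu(d^p) by p^(2n-2) = q^(2m+2). *)
Lemma exists_pth_power_near m : exists c d : K,
  [/\ d != 0, u - c ^+ p = d ^+ p * P (2 * m + 2) &
      nu (d ^+ p) = u_dist - q ^+ (2 * m + 2) / (q ^+ 2 - 1)].
Proof.
have pnat : [pchar K].-nat p by rewrite pnatE ?p_prime // pcharK.
elim: m => [|m [c [d [d0 cd nud]]]].
  exists (v ^+ p), (- 1); split.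
  - by rewrite oppr_eq0 oner_neq0.
  - by rewrite exprNn_pchar // expr1n mulN1r P_2 opprB -exprM mulnn.
  - by rewrite exprNn_pchar // expr1n val_funN ?oner_neq0 // val_fun1 /u_dist subrr.
have [n nE] : exists n, n = (2 * m + 3)%N by exists (2 * m + 3)%N.
have [e eE] : exists e, e = (4 * m + 3)%N by exists (4 * m + 3)%N.
have e_exp : (2 * n - 2 = e.+1)%N by rewrite nE eE; lia.
have n_pred : (n.-1 = 2 * m + 2)%N by rewrite nE; lia.
have n_ge2 : (2 <= n)%N by rewrite nE; lia.
have PE := P_rec _ n_ge2; rewrite e_exp n_pred in PE.
have n1E : (2 * m.+1 + 2 = n.+1)%N by rewrite nE; lia.
have [c' [d' [d'0 cd' nud']]] :=
  pth_power_approx_step _ nu p e u c d _ (P n) pcharK u_neq0 nu_u d0 cd.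
exists c', d'; rewrite n1E PE; split=> //.
rewrite nud' nud natrX; have -> : e.+1 = (2 * (2 * m + 2))%N by rewrite eE; lia.
rewrite exp_pE; have -> : (n.+1 = 2 + (2 * m + 2))%N by rewrite nE; lia.
rewrite (exprD q 2 (2 * m + 2)); move: (q ^+ (2 * m + 2)) => r.
by field; exact: q2B1_neq0.
Qed.

(** The large terms cancel and leave G - q^-(2m+2)/(q^2-1), which tends to G. *)
Lemma u_dist_approx b : b < u_dist -> exists m,
  b < u_dist - q ^+ (2 * m + 2) / (q ^+ 2 - 1) +
      (q ^+ (2 * m + 2) - (q ^+ (2 * m + 2))^-1) / (q ^+ 2 - 1).
Proof.
move=> b_lt; have G0 : 0 < u_dist - b by rewrite subr_gt0.
have x0 : 0 <= (q ^+ 2 - 1)^-1 / (u_dist - b).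
  by apply: divr_ge0; apply: ltW => //; apply: q2B1V_gt0.
have := archi_boundP x0; set m := Num.Def.archi_bound _ => m_gt; exists m.
have r_gt0 := qX_gt0 (2 * m + 2); have r_gt : m%:R < q ^+ (2 * m + 2).
  have p_gt1 := prime_gt1 p_prime.
  rewrite /q -exprM -natrX ltr_nat.
  by apply: leq_trans (ltn_expl m p_gt1) _; rewrite leq_exp2l //; lia.
move: (q ^+ (2 * m + 2)) r_gt0 r_gt => r r_gt0 r_gt.
have -> : u_dist - r / (q ^+ 2 - 1) + (r - r^-1) / (q ^+ 2 - 1) =
    u_dist - (q ^+ 2 - 1)^-1 / r by ring.
rewrite ltrBrDr -ltrBrDl ltr_pdivrMr // mulrC -ltr_pdivrMr //.
exact: lt_trans m_gt r_gt.
Qed.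

Lemma sub_pth_power_sup b : b < u_dist -> exists c : K, b < nu (u - c ^+ p).
Proof.
move=> /u_dist_approx[m m_lt]; have [c [d [d0 cd nud]]] := exists_pth_power_near m.
have Pm : P (2 * m + 2)%N != 0 by have [] := P_generating.1 (2 * m + 2)%N.
exists c; rewrite cd (val_funM nu (expf_neq0 p d0) Pm) nud nu_PE; last by rewrite addn2.
exact: m_lt.
Qed.

Lemma u_dist_gt1 : 1 < u_dist.
Proof. by rewrite u_distE ltrDl q2B1V_gt0. Qed.

(** Since q^2 >= 16 and p >= 2, G - 2 <= -14/15 < -1/2 <= -1/p. This lets w - c^p dominate theta, of
    value -1/p. *)
Lemma u_dist_lt : u_dist - 2 < - p%:R^-1.
Proof.
have h1 : (q ^+ 2 - 1)^-1 <= 15^-1.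
  by rewrite lef_pV2 ?posrE; have := q2_ge16; lra.
have h2 : p%:R^-1 <= 2^-1 :> rat by rewrite lef_pV2 ?posrE; have := p_ge2; lra.
rewrite u_distE; lra.
Qed.

End GeneratingPolynomials.

(** * Artin-Schreier extensions *)

Lemma Artin_Schreier_sub_val (F : fieldType) (L : fieldExtType F)
    (nu : valuation F) (nuL : valuation L) (p : nat) (w : F) (theta : L) :
  p \in [pchar F] -> extends nu nuL -> w != 0 -> nu w = -1 ->
  theta ^+ p - theta = w%:A ->
  (forall c : F, w - c ^+ p != 0 /\ nu (w - c ^+ p) < - p%:R^-1) ->
  forall c : F, theta != c%:A /\ nuL (theta - c%:A) = nu (w - c ^+ p) / p%:R.
Proof.
move=> pF ext w0 nu_w thE w_c c.
have p_pr := pcharf_prime pF; have p_gt0 := prime_gt0 p_pr.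
have pL : p \in [pchar L] by rewrite (rmorph_pchar (in_alg L)).
have pnat : [pchar L].-nat p by rewrite pnatE.
have pQ : 0 < p%:R :> rat by rewrite ltr0n.
have wL0 : w%:A != 0 :> L by rewrite alg_eq0.
have wL : nuL w%:A = -1 by rewrite ext.
have th0 : theta != 0.
  apply: contra_neq wL0 => th0; rewrite -thE th0 expr0n gtn_eqF // subr0 //.
have th_lt : nuL theta < 0.
  rewrite ltNge; apply/negP => th_ge.
  have : val_ge nuL 0 w%:A.
    rewrite -thE val_geB // /val_ge ?val_funX // ?th_ge ?orbT //.
    by rewrite mulrn_wge0 ?orbT.
  by rewrite /val_ge (negPf wL0) wL.
(* As nu(theta) < 0, theta^p dominates in theta^p - theta = w, of value -1. *)
have nu_th : nuL theta = - p%:R^-1.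
  have thp0 : theta ^+ p != 0 by rewrite expf_neq0.
  have : val_gt nuL (nuL (theta ^+ p)) (- theta).
    rewrite val_gtN /val_gt val_funX // (negPf th0) /=.
    rewrite -[nuL theta *+ p]mulr_natr.
    have : (1 : rat) < p%:R by rewrite ltr1n prime_gt1.
    nra.
  move=> /(val_add_dominant thp0)[_]; rewrite thE wL val_funX //.
  rewrite -[nuL theta *+ p]mulr_natr => h.
  have p0 : (p%:R : rat) != 0 by rewrite gt_eqF.
  by rewrite -[LHS](mulfK p0) -h mulN1r.
have [s0 s_lt] := w_c c.
have sL0 : (w - c ^+ p)%:A != 0 :> L by rewrite alg_eq0.
have dom : val_gt nuL (nuL (w - c ^+ p)%:A) theta.
  by rewrite /val_gt ext // nu_th s_lt orbT.
have powE : (theta - c%:A) ^+ p = (w - c ^+ p)%:A + theta.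
  rewrite exprDn_pchar // exprNn_pchar // scalerBl -thE.
  rewrite -[(c ^+ p)%:A]/(in_alg L _) rmorphXn /=; ring.
have [t0 t_val] := val_add_dominant sL0 dom.
rewrite -powE expf_eq0 p_gt0 /= in t0.
rewrite -subr_eq0; split=> //; rewrite -(ext _ s0) -t_val -powE val_funX //.
by rewrite -[nuL _ *+ p]mulr_natr mulfK ?gt_eqF.
Qed.

Lemma dependent_Artin_Schreier_criterion (F : fieldType) (L : fieldExtType F)
    (nu : valuation F) (nuL : valuation L) (p : nat) (w : F) (theta : L) (B : rat) :
  p \in [pchar F] -> extends nu nuL -> w != 0 -> nu w = -1 ->
  <<1; theta>>%VS = {:L}%VS -> theta ^+ p - theta = w%:A -> B < - p%:R^-1 ->
  (forall c : F, w - c ^+ p != 0 /\ nu (w - c ^+ p) < B) ->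
  (forall b : rat, b < B -> exists c : F, b < nu (w - c ^+ p)) ->
  dependent_Artin_Schreier_defect_extension p nu nuL.
Proof.
move=> pF ext w0 nu_w theta_gen theta_eq B_lt w_lt w_sup.
have p_pr := pcharf_prime pF; have p_gt0 := prime_gt0 p_pr.
have pQ : 0 < p%:R :> rat by rewrite ltr0n.
(* Stated for every extension of nu: uniqueness needs that they all agree at theta - c. *)
have theta_val (nuM : valuation L) : extends nu nuM -> forall c : F,
    theta != c%:A /\ nuM (theta - c%:A) = nu (w - c ^+ p) / p%:R.
  move=> extM; apply: (Artin_Schreier_sub_val _ _ _ _ _ _ _ pF extM w0 nu_w
    theta_eq) => c.
  by have [? /lt_trans-> //] := w_lt c.
have theta_gt (c : F) : theta != c%:A /\ nuL (theta - c%:A) < B / p%:R.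
  have [-> ->] := theta_val _ ext c.
  by rewrite ltr_pM2r ?invr_gt0 // (w_lt c).2.
have theta_sup (b : rat) : b < B / p%:R -> exists c : F, b < nuL (theta - c%:A).
  rewrite ltr_pdivlMr // => /w_sup[c bc]; exists c.
  by rewrite (theta_val _ ext c).2 ltr_pdivlMr.
have dimL : \dim {:L} = p.
  apply: (generator_dim pF theta_gt theta_sup ('X^p - ('X + w%:P))) => //.
    rewrite size_polyDl size_polyXn // size_polyN size_XaddC.
    by rewrite ltnS prime_gt1.
  rewrite rootE rmorphB rmorphD /= map_polyXn map_polyX map_polyC !hornerE.
  by rewrite opprD addrA theta_eq subrr.
have thetaAS : Artin_Schreier_generator p theta by split=> //; exists w.
have imm := generator_immediate pF ext theta_gt theta_sup theta_gen dimL.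
have uniq : unique_extension nu nuL.
  apply: (generator_unique_extension _ _ _ _ _ _ _ pF theta_gen dimL
    ext _ theta_gt theta_sup) => nuM extM c.
  by rewrite (theta_val _ extM c).2 (theta_val _ ext c).2.
split; first split; first by exists theta.
  exact: (immediate_defect_extension _ _ _ _ _ pF dimL imm uniq).
exists theta => //.
have w_npow (c : F) : c ^+ p != w.
  by have [] := w_lt c; rewrite subr_eq0 eq_sym.
have [E [eta [dimE eta_gen eta_pow]]] := exists_root_ext _ _ _ p_pr w_npow.
pose nuE := root_valuation pF eta_gen eta_pow nu.
have pnat : [pchar E].-nat p by rewrite pnatE // (rmorph_pchar (in_alg E)).
have eta_val (c : F) : nuE (eta - c%:A) = nu (w - c ^+ p) / p%:R.
  apply: root_valuation_pow; rewrite exprDn_pchar // exprNn_pchar // eta_pow.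
  by rewrite scalerBl -[(c ^+ p)%:A]/(in_alg E _) rmorphXn.
have nuE_ext : extends nu nuE by apply: root_valuation_extends.
have eta_gt (c : F) : eta != c%:A /\ nuE (eta - c%:A) < B / p%:R.
  rewrite eta_val ltr_pM2r ?invr_gt0 // (w_lt c).2; split=> //.
  apply: contra_neq (w_npow c) => eta_c.
  by apply: (fmorph_inj (in_alg E)); rewrite rmorphXn /= -eta_c eta_pow.
have eta_sup (b : rat) : b < B / p%:R -> exists c : F, b < nuE (eta - c%:A).
  rewrite ltr_pdivlMr // => /w_sup[c bc]; exists c.
  by rewrite eta_val ltr_pdivlMr.
exists E, nuE, eta; split=> //.
- exact: (generator_immediate pF nuE_ext eta_gt eta_sup eta_gen dimE).
- exact: purely_inseparable_root pF eta_gen eta_pow.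
- by move=> c; rewrite eta_val (theta_val _ ext c).2.
Qed.

Lemma inv_Artin_Schreier_generator (F : fieldType) (L : fieldExtType F)
    (p : nat) (u : F) (x : L) : (0 < p)%N -> u != 0 ->
  u%:A = x ^+ p / (1 - x ^+ p.-1) -> <<1; x>>%VS = {:L}%VS ->
  x^-1 ^+ p - x^-1 = (u^-1)%:A /\ <<1; x^-1>>%VS = {:L}%VS.
Proof.
move=> p_gt0 u0 x_eq x_gen; have uA0 : u%:A != 0 :> L by rewrite alg_eq0.
have x0 : x != 0.
  by apply: contra_neq uA0 => x0; rewrite x_eq x0 expr0n gtn_eqF // mul0r.
(* With the convention 0^-1 = 0, a zero denominator would make u zero. *)
have y0 : 1 - x ^+ p.-1 != 0.
  by apply: contra_neq uA0 => y0; rewrite x_eq y0 invr0 mulr0.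
split; last first.
  apply/eqP; rewrite eqEsubv subvf -x_gen /=; apply/FadjoinP.
  by rewrite sub1v -{1}[x]invrK memvV memv_adjoin.
rewrite -[(u^-1)%:A]/(in_alg L _) fmorphV /= x_eq; case: p p_gt0 {x_eq} y0 => //= n _ y0.
rewrite exprVn !exprS; field.
by rewrite x0 y0 expf_neq0.
Qed.

Theorem theorem4p6
    (k : closedFieldType) (p : nat) (pchark : p \in [pchar k])
    (nu : valuation (ratfun2 k))
    (P : nat -> ratfun2 k)
    (nu_trivial : forall c : k, c != 0 -> nu (ratfun2_const c) = 0)
    (nu_centered : centered_in_local_ring_uv nu)
    (P_0 : P 0%N = ratfun2_u k)
    (P_1 : P 1%N = ratfun2_v k)
    (P_2 : P 2%N = ratfun2_v k ^+ (p ^ 2) - ratfun2_u k)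
    (P_rec : forall i : nat, (2 <= i)%N ->
      P i.+1 = P i ^+ (p ^ 2) - ratfun2_u k ^+ (p ^ (2 * i - 2)) * P i.-1)
    (P_generating : generating_sequence (@local_ring_uv k) nu P)
    (nu_P0 : nu (P 0%N) = 1)
    (nu_P : forall i : nat, (1 <= i)%N ->
      nu (P i) = \sum_(0 <= j < i) (p%:R : rat) ^ ((4 * j)%:Z - (2 * i)%:Z))
    (K1 : fieldExtType (ratfun2 k)) (x : K1)
    (x_generates : <<1; x>>%VS = {:K1}%VS)
    (x_eq : (ratfun2_u k)%:A = x ^+ p / (1 - x ^+ p.-1))
    (nu1 : valuation K1) (nu1_extends : extends nu nu1) :
  dependent_Artin_Schreier_defect_extension p nu nu1.
Proof.
have p_gt0 := prime_gt0 (p_prime pchark); have u0 := u_neq0 (k := k).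
have nu_u : nu (ratfun2_u k) = 1 by rewrite -P_0.
have [theta_eq theta_gen] :=
  inv_Artin_Schreier_generator _ _ _ _ _ p_gt0 u0 x_eq x_generates.
have u_lt := sub_pth_power_lt pchark nu_centered P_0 P_1 P_2 P_rec P_generating
  nu_P0 nu_P.
have u_sup := sub_pth_power_sup pchark P_0 P_2 P_rec P_generating nu_P0 nu_P.
have G_gt1 := u_dist_gt1 pchark.
apply: (dependent_Artin_Schreier_criterion _ _ _ _ _ _ _ (u_dist (p := p) - 2)
  (pcharK pchark) nu1_extends _ _ theta_gen theta_eq (u_dist_lt pchark)).
- by rewrite invr_eq0.
- by rewrite (val_funV _ u0) nu_u.
- exact: inv_sub_pth_power_lt p_gt0 u0 nu_u G_gt1 u_lt.
- exact: inv_sub_pth_power_sup u0 nu_u G_gt1 (fun c => (u_lt c).1) u_sup.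
Qed.
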